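(* Let $\lambda$ be a nonzero cardinal, $S$ a monoid and $\theta\colon S\to H_S(1_S)$ a homomorphism. Let $\tau$ be a Hausdorff translation-continuous topology on the semigroup $\mathscr{P}_\lambda(\theta,S)$ such that $S_\varepsilon$ is a closed subset of the topological space $(\mathscr{P}_\lambda(\theta,S),\tau)$. Then $S_{u^{-1}v}$ is a closed subset of $(\mathscr{P}_\lambda(\theta,S),\tau)$ for all words $u,v\in\lambda^*$.
   Context: A topology $\tau$ on a semigroup $T$ is translation-continuous if the semigroup operation is separately continuous with respect to $\tau$ (all left and right translations are continuous). For a nonzero cardinal $\lambda$, $\lambda^*$ is the free monoid over the alphabet $\lambda$, $\varepsilon$ is the empty word and $|a|$ is the length of a word $a$. The $\lambda$-polycyclic monoid $P_\lambda$ is the semigroup with zero $0$ and identity $1$ generated by $\{p_i\}_{i\in\lambda}\cup\{p_i^{-1}\}_{i\in\lambda}$ subject to $p_ip_i^{-1}=1$ and $p_ip_j^{-1}=0$ for $i\ne j$ (for $\lambda=1$ it is the bicyclic monoid with adjoined zero). Identifying words of $\lambda^*$ with products of the $p_i$, each nonzero element of $P_\lambda$ is uniquely of the form $a^{-1}b$ with $a,b\in\lambda^*$; the identity of $P_\lambda$ is $\varepsilon=\varepsilon^{-1}\varepsilon$. For a monoid $S$ with identity $1_S$, $H_S(1_S)$ is its group of units. Given a homomorphism $\theta\colon S\to H_S(1_S)$, put $\theta^0(s)=s$ and $\theta^n=\theta\circ\cdots\circ\theta$ ($n$ times). The Bruck–Reilly $\lambda$-polycyclic extension is the set $\mathscr{P}_\lambda(\theta,S)=(S\times(P_\lambda\setminus\{0\}))\sqcup\{\boldsymbol{0}\}$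 with the associative operation $*$ for which $\boldsymbol{0}$ is a zero and $$(s,a_1^{-1}a_2)*(t,b_1^{-1}b_2)=\begin{cases}(\theta^{|u|}(s)t,(ua_1)^{-1}b_2), & \text{if } b_1=ua_2 \text{ for some } u\in\lambda^*,\\ (s\theta^{|v|}(t),a_1^{-1}vb_2), & \text{if } a_2=vb_1 \text{ for some } v\in\lambda^*,\\ \boldsymbol{0}, & \text{otherwise.}\end{cases}$$ For $u,v\in\lambda^*$, $S_{u^{-1}v}=\{(s,u^{-1}v)\colon s\in S\}\subseteq\mathscr{P}_\lambda(\theta,S)$; in particular $S_\varepsilon=\{(s,\varepsilon)\colon s\in S\}$. *)

(* Defs.v *)
From HB Require Import structures.
From mathcomp Require Import all_boot.
From mathcomp Require Import boolp classical_sets topology.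

Set Implicit Arguments.
Unset Strict Implicit.
Unset Printing Implicit Defensive.

Local Open Scope classical_set_scope.
Local Open Scope group_scope.

(* A cardinal is represented by an alphabet L : choiceType, and L^* by seq L.
   Since every type carries a choiceType structure classically, neither this
   nor the choiceType underlying monoidType is a restriction. *)

Section Words.
Context {L : choiceType}.
Implicit Types p q r u v : seq L.

(* The word u such that q = u ++ p, when p is a suffix of q. *)
Definition cofactor q p : seq L := take (size q - size p) q.

Lemma cofactor_cat u p : cofactor (u ++ p) p = u.
Proof. by rewrite /cofactor size_cat addnK take_size_cat. Qed.

Lemma suffix_comparable p q r : suffix p r -> suffix q r ->
  suffix p q || suffix q p.
Proof.
have aux a b : suffix a r -> suffix b r -> size a <= size b -> suffix a b.
  move=> ar br le_ab; move: (size_suffix br) => le_br.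
  move: ar br; rewrite !suffixE => /eqP ea /eqP eb.
  by rewrite -[X in drop _ X == _]eb drop_drop addnC addnBA ?subnK ?ea.
move=> pr qr; case: (leqP (size p) (size q)) => [le|/ltnW le].
  by rewrite aux.
by rewrite (aux q p) ?orbT.
Qed.

Lemma suffix_cat2 p u v : suffix (u ++ p) (v ++ p) = suffix u v.
Proof. by rewrite suffix_catl // eqxx. Qed.

Lemma suffix_catN p q v : ~~ suffix p q -> ~~ suffix q p ->
  ~~ suffix (v ++ p) q /\ ~~ suffix q (v ++ p).
Proof.
move=> pq qp; split; apply/negP.
  by move=> /catl_suffix; rewrite (negPf pq).
move=> /suffix_comparable/(_ (suffix_suffix v p)).
by rewrite (negPf pq) (negPf qp).
Qed.

End Words.

(* (a, b) stands for the nonzero element a^{-1} b of the polycyclic monoid. *)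
Definition pform (L : choiceType) : Type := (seq L * seq L)%type.

HB.instance Definition _ (L : choiceType) :=
  Choice.copy (pform L) (seq L * seq L)%type.

(* The carrier S x (P_L \ {0}) together with an adjoined zero None; it depends
   on theta only so that the semigroup structure can be inferred. *)
Definition bruck_reilly (L : choiceType) (S : monoidType)
  (theta : {multiplicative S -> S}) : Type := option (S * pform L).

HB.instance Definition _ (L : choiceType) (S : monoidType)
    (theta : {multiplicative S -> S}) :=
  Choice.copy (bruck_reilly L theta) (option (S * pform L)).

Section BruckReilly.
Context {L : choiceType} {S : monoidType} {theta : {multiplicative S -> S}}.
Implicit Types (a b c u v w : seq L) (s t r : S).

Definition br_mul (x y : bruck_reilly L theta) : bruck_reilly L theta :=
  match x, y with
  | Some (s, (a1, a2)), Some (t, (b1, b2)) =>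
      if suffix a2 b1 then
        let u := cofactor b1 a2 in
        Some (iter (size u) theta s * t, (u ++ a1, b2))
      else if suffix b1 a2 then
        let v := cofactor a2 b1 in
        Some (s * iter (size v) theta t, (a1, v ++ b2))
      else None
  | _, _ => None
  end.

Lemma br_mulL s t a1 a2 b2 u :
  br_mul (Some (s, (a1, a2))) (Some (t, (u ++ a2, b2))) =
  Some (iter (size u) theta s * t, (u ++ a1, b2)).
Proof. by rewrite /= suffix_suffix cofactor_cat. Qed.

Lemma br_mulR s t a1 b1 b2 v :
  br_mul (Some (s, (a1, v ++ b1))) (Some (t, (b1, b2))) =
  Some (s * iter (size v) theta t, (a1, v ++ b2)).
Proof.
case: (posnP (size v)) => [/size0nil-> //|v_gt0].
  by rewrite /= suffix_refl /cofactor subnn take0.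
rewrite /= suffix_suffix cofactor_cat.
case: ifP => // /size_suffix; rewrite size_cat -[X in _ <= X]add0n leq_add2r.
by rewrite leqNgt v_gt0.
Qed.

Lemma br_mulN s t a1 a2 b1 b2 : ~~ suffix a2 b1 -> ~~ suffix b1 a2 ->
  br_mul (Some (s, (a1, a2))) (Some (t, (b1, b2))) = None.
Proof. by rewrite /= => /negPf-> /negPf->. Qed.

Lemma br_mulx0 x : br_mul x None = None.
Proof. by case: x => [[s [a1 a2]]|]. Qed.

Lemma iter_thetaM n s t :
  iter n theta (s * t) = iter n theta s * iter n theta t.
Proof. by elim: n => //= n ->; rewrite gmulfM. Qed.

Lemma br_mulA : associative br_mul.
Proof.
move=> [[s [a1 a2]]|] // [[t [b1 b2]]|] // [[r [c1 c2]]|]; last first.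
  by rewrite !br_mulx0.
have [/suffixP[u ->]|Nab] := boolP (suffix a2 b1).
  rewrite br_mulL.
  have [/suffixP[w ->]|Nbc] := boolP (suffix b2 c1).
    rewrite !br_mulL (catA w u a2) br_mulL size_cat -catA iterD iter_thetaM.
    by rewrite mulgA.
  have [/suffixP[w ->]|Ncb] := boolP (suffix c1 b2).
    by rewrite !br_mulR br_mulL mulgA.
  by rewrite !br_mulN.
have [/suffixP[v ->]|Nba] := boolP (suffix b1 a2).
  rewrite br_mulR.
  have [/suffixP[w ->]|Nbc] := boolP (suffix b2 c1).
    rewrite br_mulL.
    have [/suffixP[u ->]|Nvw] := boolP (suffix v w).
      by rewrite -!catA !br_mulL iter_thetaM -iterD size_cat mulgA.
    have [/suffixP[u ->]|Nwv] := boolP (suffix w v).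
      by rewrite -!catA !br_mulR iter_thetaM -iterD size_cat mulgA.
    by rewrite !br_mulN // suffix_cat2.
  have [/suffixP[w ->]|Ncb] := boolP (suffix c1 b2).
    rewrite br_mulR (catA v w c1) !br_mulR iter_thetaM -iterD size_cat mulgA.
    by rewrite -catA.
  have [h1 h2] := suffix_catN v Nbc Ncb.
  by rewrite !br_mulN.
rewrite [br_mul (Some (s, _)) (Some (t, _))]br_mulN //.
have [/suffixP[w ->]|Nbc] := boolP (suffix b2 c1).
  have [h1 h2] := suffix_catN w Nba Nab.
  by rewrite br_mulL br_mulN.
have [/suffixP[w ->]|Ncb] := boolP (suffix c1 b2).
  by rewrite br_mulR br_mulN.
by rewrite [br_mul (Some (t, _)) _]br_mulN.
Qed.

HB.instance Definition _ := isSemigroup.Build (bruck_reilly L theta) br_mulA.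

End BruckReilly.

(* The polycyclic monoid in normal form, None being its zero. That it is the
   monoid with zero presented by p_i p_i^{-1} = 1 and p_i p_j^{-1} = 0 for
   i <> j is the content of pgenK, pgenV0 and polycyclic_universal. *)
Definition polycyclic (L : choiceType) : Type := option (pform L).

HB.instance Definition _ (L : choiceType) :=
  Choice.copy (polycyclic L) (option (pform L)).

Definition trivial_monoid : Type := unit.
HB.instance Definition _ := Choice.copy trivial_monoid unit.
Definition trivial_mul (_ _ : trivial_monoid) : trivial_monoid := tt.
Lemma trivial_mulA : associative trivial_mul. Proof. by []. Qed.
Lemma trivial_mul1 : left_id (tt : trivial_monoid) trivial_mul.
Proof. by case. Qed.
Lemma trivial_mulr1 : right_id (tt : trivial_monoid) trivial_mul.
Proof. by case. Qed.
HB.instance Definition _ :=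
  isMonoid.Build trivial_monoid trivial_mulA trivial_mul1 trivial_mulr1.

Section Polycyclic.
Context {L : choiceType}.
Implicit Types (a b : seq L) (i j : L) (x y : polycyclic L).

Definition pmul x y : polycyclic L :=
  match x, y with
  | Some (a1, a2), Some (b1, b2) =>
      if suffix a2 b1 then Some (cofactor b1 a2 ++ a1, b2)
      else if suffix b1 a2 then Some (a1, cofactor a2 b1 ++ b2)
      else None
  | _, _ => None
  end.

Let lift x : bruck_reilly L (@idfun trivial_monoid : {multiplicative _ -> _})
  := omap (pair tt) x.

Let liftM x y : lift (pmul x y) = br_mul (lift x) (lift y).
Proof.
case: x y => [[a1 a2]|] [[b1 b2]|] //=.
by case: ifP => _ //; case: ifP.
Qed.

Let lift_inj : injective lift.
Proof. by move=> [x|] [y|] //= [->]. Qed.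

Definition pzero : polycyclic L := None.
Definition pone : polycyclic L := Some ([::], [::]).
Definition pgen i : polycyclic L := Some ([::], [:: i]).
Definition pgenV i : polycyclic L := Some ([:: i], [::]).

Lemma pmulA : associative pmul.
Proof. by move=> x y z; apply: lift_inj; rewrite !liftM br_mulA. Qed.

Lemma pmul1 : left_id pone pmul.
Proof.
by case=> [[a b]|] //=; rewrite suffix0s /cofactor subn0 take_size cats0.
Qed.

Lemma pmulr1 : right_id pone pmul.
Proof.
case=> [[a b]|] //=; rewrite suffix0s suffixs0 /cofactor subn0 take_size cats0.
by case: eqP => // ->.
Qed.

HB.instance Definition _ := isMonoid.Build (polycyclic L) pmulA pmul1 pmulr1.

Lemma pmul0x x : pzero * x = pzero.
Proof. by []. Qed.

Lemma pmulx0 x : x * pzero = pzero.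
Proof. by case: x => [[]|]. Qed.

Lemma pgenK i : pgen i * pgenV i = 1.
Proof. by rewrite /mul /= suffix_refl. Qed.

Lemma pgenV0 i j : i <> j -> pgen i * pgenV j = pzero.
Proof.
move=> ij; rewrite /mul /= -![[:: _]]/(rcons [::] _) !suffix_rcons.
by rewrite ifN ?ifN //; apply/negP => /andP[/eqP]; auto.
Qed.

Lemma pmul_form a b :
  (Some (a, [::]) : polycyclic L) * (Some ([::], b) : polycyclic L) =
  Some (a, b).
Proof. by []. Qed.

Lemma pmul_pgen i b : pgen i * (Some ([::], b) : polycyclic L) =
  Some ([::], i :: b).
Proof. by []. Qed.

Lemma pmul_pgenV i a : (Some (a, [::]) : polycyclic L) * pgenV i =
  Some (i :: a, [::]).
Proof. by []. Qed.

Theorem polycyclic_universal (M : monoidType) (z : M) (f g : L -> M) :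
  (forall m, z * m = z) -> (forall m, m * z = z) ->
  (forall i, f i * g i = 1) -> (forall i j, i <> j -> f i * g j = z) ->
  exists! h : polycyclic L -> M,
    [/\ {morph h : x y / x * y}, h 1 = 1, h pzero = z,
        h \o pgen =1 f & h \o pgenV =1 g].
Proof.
move=> z0 zr fg1 fgz.
pose F b := foldr (fun i m => f i * m) 1 b.
pose G a := foldr (fun i m => m * g i) 1 a.
have Fcat a b : F (a ++ b) = F a * F b.
  by elim: a => [|i a IH] /=; rewrite ?mul1g // IH mulgA.
have Gcat a b : G (a ++ b) = G b * G a.
  by elim: a => [|i a IH] /=; rewrite ?mulg1 // IH mulgA.
have FG a : F a * G a = 1.
  by elim: a => [|i a IH] /=; rewrite ?mulg1 // mulgA -(mulgA (f i)) IH mulg1.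
have FGz a b : ~~ suffix a b -> ~~ suffix b a -> F a * G b = z.
  elim/last_ind: a b => [|a i IH] b; first by rewrite suffix0s.
  elim/last_ind: b => [|b j _]; first by rewrite suffix0s.
  rewrite !suffix_rcons -!cats1 Fcat Gcat /= mulg1 mul1g.
  rewrite mulgA -(mulgA (F a)); case: (eqVneq i j) => [->|/eqP ij] /=.
    by rewrite fg1 mulg1; apply: IH.
  by rewrite fgz // zr z0.
pose h (x : polycyclic L) := if x is Some (a, b) then G a * F b else z.
exists h; split; first split => //=.
- move=> [[a1 a2]|] [[b1 b2]|] /=; rewrite ?zr ?z0 //.
  rewrite -[X in h X]/(pmul _ _) /=.
  have [/suffixP[u ->]|Nab] := boolP (suffix a2 b1).
    by rewrite cofactor_cat /= !Gcat -!mulgA (mulgA (F a2)) FG mul1g.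
  have [/suffixP[v ->]|Nba] := boolP (suffix b1 a2).
    by rewrite cofactor_cat /= !Fcat -!mulgA (mulgA (F b1)) FG mul1g.
  by rewrite /= mulgA -(mulgA _ (F a2)) FGz // zr z0.
- by rewrite mulg1.
- by move=> i; rewrite /= !(mulg1, mul1g).
- by move=> i; rewrite /= !(mulg1, mul1g).
move=> k [kM k1 k0 kf kg]; apply/funext => -[[a b]|] //=.
rewrite -pmul_form kM; congr (_ * _).
- elim: a => [|i a IH] /=; first exact: esym k1.
  by rewrite IH -(kg i) /= -kM pmul_pgenV.
- elim: b => [|i b IH] /=; first exact: esym k1.
  by rewrite IH -(kf i) /= -kM pmul_pgen.
Qed.

End Polycyclic.

(* The group of units H_S(1_S), as a subset of S. *)
Definition units (S : monoidType) : set S :=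
  [set x | exists y : S, x * y = 1 /\ y * x = 1].

(* The set S_{u^{-1} v}. *)
Definition br_slice {L : choiceType} {S : monoidType}
    (theta : {multiplicative S -> S}) (u v : seq L) :
    set (bruck_reilly L theta) :=
  [set Some (s, (u, v)) | s in [set: S]].
Arguments br_slice {L S} theta u v.

(* The set X endowed with an arbitrary topology tau; going through this type
   keeps any topology inferred from the shape of X out of the way. *)
Definition topologized (X : Type) (tau : Topological X) : topologicalType :=
  Topological.Pack tau.

Definition translation_continuous (X : semigroupType) (tau : Topological X) :=
  forall a : X,
    continuous ((fun x => a * x) : topologized tau -> topologized tau) /\
    continuous ((fun x => x * a) : topologized tau -> topologized tau).

(* Main.v *)
Require Import Defs.
From HB Require Import structures.
From mathcomp Require Import all_boot.
From mathcomp Require Import boolp classical_sets topology.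

Set Implicit Arguments.
Unset Strict Implicit.
Unset Printing Implicit Defensive.

Local Open Scope classical_set_scope.
Local Open Scope group_scope.

(** The continuous map f : x |-> u x v^{-1} sends S_{u^{-1} v} into S_eps, but
    the preimage of S_eps also contains S_{a^{-1} b} whenever u = w a and
    v = w b. These extra slices are cut off by the idempotent u^{-1} u: a nonzero
    x fixed by left translation by u^{-1} u has first word ending in u, so that
      S_{u^{-1} v} = f^{-1}(S_eps) `&` {x | u^{-1} u x = x}.
    The second set is closed because the topology is Hausdorff. *)

(** For [x] in the closure, a fixed point close to [x] lies in any given neighbourhoods of [f x] and
    of [x], so these cannot be separated. *)
Lemma closed_fixpoints (T : topologicalType) (f : T -> T) :
  hausdorff_space T -> continuous f -> closed [set x | f x = x].
Proof.
move=> hT cf x clx; apply: hT => A B nA nB.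
have nfA : nbhs x (f @^-1` A) := cf x A nA.
have [y [fy [Afy By]]] := clx _ (filterI nfA nB).
by exists y; split=> //; rewrite -(fy : f y = y).
Qed.

Section Slices.
Context {L : choiceType} {S : monoidType} {theta : {multiplicative S -> S}}.
Implicit Types (a b c u v : seq L) (x : bruck_reilly L theta).

Lemma br_mul_cancel (s t : S) a b c :
  br_mul (Some (s, (a, c)) : bruck_reilly L theta) (Some (t, (c, b))) =
  Some (s * t, (a, b)).
Proof. exact: (br_mulL s t a c b [::]). Qed.

(** Left translation by [(1, (u, u))] yields either zero or an element whose first word ends in
    [u]. *)
Lemma br_mul_idem_fix u x :
  br_mul (Some (1, (u, u))) x = x ->
  x = None \/ exists t w b, x = Some (t, (w ++ u, b)).
Proof.
case: x => [[t [a b]]|]; last by left.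
have [/suffixP[w ->] _|Nua] := boolP (suffix u a).
  by right; exists t, w, b.
have [/suffixP[w uE]|Nau] := boolP (suffix a u); last by rewrite br_mulN.
rewrite {2}uE br_mulR => -[_ ua _].
by move: Nua; rewrite ua suffix_refl.
Qed.

Lemma br_slice_preimage u v :
  br_slice theta u v =
  (fun x => br_mul (br_mul (Some (1, ([::], u))) x) (Some (1, (v, [::]))))
    @^-1` br_slice theta [::] [::]
  `&` [set x | br_mul (Some (1, (u, u))) x = x].
Proof.
apply/seteqP; split=> [_ [s _ <-]|x [[s _ xs] /br_mul_idem_fix[x0|]]].
- split; last by rewrite /mkset br_mul_cancel mul1g.
  by rewrite /preimage /mkset !br_mul_cancel mul1g mulg1; exists s.
- by rewrite x0 in xs.
case=> t [w [b xE]]; move: xs; rewrite {}xE br_mulL cats0.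
have [/suffixP[r ->]|Nbv] := boolP (suffix b v).
  (* The product has words [r ++ w] and [[::]]; membership in the slice of the empty words forces
     [r] and [w] to be empty. *)
  by rewrite br_mulL; case: r w => [|? ?] [|? ?] //= _; exists t.
have [/suffixP[r ->]|Nvb] := boolP (suffix v b); last by rewrite br_mulN.
by rewrite br_mulR cats0; case: r w => [|? ?] [|? ?] //= _; exists t.
Qed.

End Slices.

Theorem mainTheorem11 (L : choiceType) (S : monoidType)
    (theta : {multiplicative S -> S})
    (tau : Topological (bruck_reilly L theta)) :
  inhabited L ->
  (forall s : S, units (theta s)) ->
  hausdorff_space (topologized tau) ->
  translation_continuous tau ->
  closed (br_slice theta [::] [::] : set (topologized tau)) ->
  forall u v : seq L, closed (br_slice theta u v : set (topologized tau)).
Proof.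
move=> _ _ hT ctau clS u v; rewrite br_slice_preimage.
apply: (@closedI (topologized tau)).
  (* The map is a left translation followed by a right one, so the slice is pulled back through the
     right one first. *)
  have [_ /continuous_closedP cr] := ctau (Some (1, (v, [::]))).
  have [/continuous_closedP cl _] := ctau (Some (1, ([::], u))).
  exact: cl _ (cr _ clS).
have [cu _] := ctau (Some (1, (u, u))).
exact: closed_fixpoints hT cu.
Qed.
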